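(* If $\mathbf{C}$ is a firm monoidal category, then the category $\mathcal{S}[\mathbf{C}]$ is a restriction category, where the restriction of a morphism $[s,f]\colon A\to B$ (with $s\colon S\rightarrowtail I$ a subunit and $f\colon A\otimes S\to B$) is $$\overline{[s,f]}=[s,\ \rho_A\circ(A\otimes s)]\colon A\to A .$$
   Context: Notation: $\otimes$, $I$, $\lambda_A\colon I\otimes A\to A$, $\rho_A\colon A\otimes I\to A$, $\alpha_{A,B,C}\colon A\otimes(B\otimes C)\to(A\otimes B)\otimes C$ are the monoidal structure; the identity on $A$ is also written $A$. A subunit is a subobject of $I$ represented by a monomorphism $s\colon S\rightarrowtail I$ such that $s\otimes S$ is invertible. A firm monoidal category is a braided monoidal category in which $s\otimes T\colon S\otimes T\to I\otimes T$ is monic for all subunits $s\colon S\rightarrowtail I$, $t\colon T\rightarrowtail I$. The subunits then form a semilattice under $s\wedge t=\lambda_I\circ(s\otimes t)\colon S\otimes T\rightarrowtail I$. For a firm monoidal category $\mathbf C$, the category $\mathcal{S}[\mathbf C]$ has the objects of $\mathbf C$; morphisms $A\to B$ are equivalence classes $[s,f]$ of pairs of a subunit $s\colon S\rightarrowtail I$ and a morphism $f\colon A\otimes S\to B$ of $\mathbf C$, where $(s,f)\sim(s',f')$ iff $s'=s\circ m$ and $f'=f\circ(A\otimes m)$ for an isomorphism $m\colon S'\to S$; identities are $[1_I,\rho_A]$; composition of $[s,f]\colon A\to B$ and $[t,g]\colon B\to C$ is $[t,g]\circ[s,f]=[s\wedge t,\ g\circ(f\otimes T)\circ\alpha_{A,S,T}]$.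 A restriction category is a category with a choice of $\overline{f}\colon A\to A$ for each $f\colon A\to B$ such that (R1) $f\circ\overline f=f$; (R2) $\overline f\circ\overline g=\overline g\circ\overline f$ if $\mathrm{dom}(f)=\mathrm{dom}(g)$; (R3) $\overline{g\circ\overline f}=\overline g\circ\overline f$ if $\mathrm{dom}(f)=\mathrm{dom}(g)$; (R4) $\overline g\circ f=f\circ\overline{g\circ f}$ if $\mathrm{cod}(f)=\mathrm{dom}(g)$. *)

(* Defs.v *)
From Corelib Require Import ssreflect ssrfun ssrbool.
From Stdlib Require Import FunctionalExtensionality PropExtensionality ProofIrrelevance.

Set Implicit Arguments.
Unset Strict Implicit.
Unset Printing Implicit Defensive.

Declare Scope cat_scope.
Delimit Scope cat_scope with cat.
Open Scope cat_scope.

Reserved Notation "g ∘ f" (at level 40, left associativity).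
Reserved Notation "A ⊗ B" (at level 35, right associativity).
Reserved Notation "f ⊗ₘ g" (at level 35, right associativity).

Record Category := {
  Ob :> Type;
  Hom : Ob -> Ob -> Type;
  idm : forall A, Hom A A;
  comp : forall A B C, Hom B C -> Hom A B -> Hom A C;
  compA : forall A B C D (h : Hom C D) (g : Hom B C) (f : Hom A B),
    comp h (comp g f) = comp (comp h g) f;
  comp1m : forall A B (f : Hom A B), comp (idm B) f = f;
  compm1 : forall A B (f : Hom A B), comp f (idm A) = f
}.
Arguments Hom {c} A B.
Arguments idm {c} A.
Arguments comp {c A B C} g f.

Notation "g ∘ f" := (comp g f) : cat_scope.

Definition monic (C : Category) (A B : C) (f : Hom A B) : Prop :=
  forall (X : C) (u v : Hom X A), f ∘ u = f ∘ v -> u = v.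

Record Iso (C : Category) (A B : C) := {
  fwd :> Hom A B;
  bwd : Hom B A;
  bwd_fwd : bwd ∘ fwd = idm A;
  fwd_bwd : fwd ∘ bwd = idm B
}.
Arguments bwd {C A B} i.

Definition invertible (C : Category) (A B : C) (f : Hom A B) : Prop :=
  exists i : Iso A B, fwd i = f.

Record RestrictionStructure (C : Category) := {
  restr : forall A B : C, Hom A B -> Hom A A;
  R1 : forall (A B : C) (f : Hom A B), f ∘ restr f = f;
  R2 : forall (A B B' : C) (f : Hom A B) (g : Hom A B'),
    restr f ∘ restr g = restr g ∘ restr f;
  R3 : forall (A B B' : C) (f : Hom A B) (g : Hom A B'),
    restr (g ∘ restr f) = restr g ∘ restr f;
  R4 : forall (A B B' : C) (f : Hom A B) (g : Hom B B'),
    restr g ∘ f = f ∘ restr (g ∘ f)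
}.
Arguments restr {C} r {A B} f.

Record MonoidalCategory := {
  mon_cat :> Category;
  unit_ob : mon_cat;
  tens : mon_cat -> mon_cat -> mon_cat
    where "A ⊗ B" := (tens A B);
  tensm : forall A B A' B' : mon_cat,
    Hom A B -> Hom A' B' -> Hom (A ⊗ A') (B ⊗ B')
    where "f ⊗ₘ g" := (tensm f g);
  tensm_id : forall A A' : mon_cat, idm A ⊗ₘ idm A' = idm (A ⊗ A');
  tensm_comp : forall (A B D A' B' D' : mon_cat)
      (g : Hom B D) (f : Hom A B) (g' : Hom B' D') (f' : Hom A' B'),
    (g ∘ f) ⊗ₘ (g' ∘ f') = (g ⊗ₘ g') ∘ (f ⊗ₘ f');
  lam : forall A : mon_cat, Iso (unit_ob ⊗ A) A;
  lam_nat : forall (A B : mon_cat) (f : Hom A B),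
    lam B ∘ (idm unit_ob ⊗ₘ f) = f ∘ lam A;
  rho : forall A : mon_cat, Iso (A ⊗ unit_ob) A;
  rho_nat : forall (A B : mon_cat) (f : Hom A B),
    rho B ∘ (f ⊗ₘ idm unit_ob) = f ∘ rho A;
  alpha : forall A B D : mon_cat, Iso (A ⊗ (B ⊗ D)) ((A ⊗ B) ⊗ D);
  alpha_nat : forall (A A' B B' D D' : mon_cat)
      (f : Hom A A') (g : Hom B B') (h : Hom D D'),
    alpha A' B' D' ∘ (f ⊗ₘ (g ⊗ₘ h)) = ((f ⊗ₘ g) ⊗ₘ h) ∘ alpha A B D;
  triangle : forall A B : mon_cat,
    (rho A ⊗ₘ idm B) ∘ alpha A unit_ob B = idm A ⊗ₘ lam B;
  pentagon : forall A B D E : mon_cat,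
    alpha (A ⊗ B) D E ∘ alpha A B (D ⊗ E) =
    (alpha A B D ⊗ₘ idm E) ∘ alpha A (B ⊗ D) E ∘ (idm A ⊗ₘ alpha B D E)
}.
Arguments unit_ob {m}.
Arguments tens {m} A B.
Arguments tensm {m A B A' B'} f g.
Arguments lam {m} A.
Arguments rho {m} A.
Arguments alpha {m} A B D.

Notation "A ⊗ B" := (tens A B) : cat_scope.
Notation "f ⊗ₘ g" := (tensm f g) : cat_scope.

Record BraidedCategory := {
  braid_mon :> MonoidalCategory;
  braid : forall A B : braid_mon, Iso (A ⊗ B) (B ⊗ A);
  braid_nat : forall (A A' B B' : braid_mon) (f : Hom A A') (g : Hom B B'),
    braid A' B' ∘ (f ⊗ₘ g) = (g ⊗ₘ f) ∘ braid A B;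
  hexagon_l : forall A B D : braid_mon,
    alpha D A B ∘ braid (A ⊗ B) D ∘ alpha A B D =
    (braid A D ⊗ₘ idm B) ∘ alpha A D B ∘ (idm A ⊗ₘ braid B D);
  hexagon_r : forall A B D : braid_mon,
    bwd (alpha B D A) ∘ braid A (B ⊗ D) ∘ bwd (alpha A B D) =
    (idm B ⊗ₘ braid A D) ∘ bwd (alpha B A D) ∘ (braid A B ⊗ₘ idm D)
}.

(** A representative of a subobject of the unit object; passing to another
    representative is part of [sequiv] below. *)
Record Subunit (C : MonoidalCategory) := {
  su_dom : C;
  su_mor : Hom su_dom unit_ob;
  su_monic : monic su_mor;
  su_idem : invertible (su_mor ⊗ₘ idm su_dom)
}.

Record FirmCategory := {
  firm_braid :> BraidedCategory;
  firmP : forall s t : Subunit firm_braid,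
    monic (su_mor s ⊗ₘ idm (su_dom t))
}.

Section Coherence.
Variable C : MonoidalCategory.
Notation I := (@unit_ob C).

Lemma iso_monic (A B : C) (i : Iso A B) : monic (fwd i).
Proof.
move=> X u v E.
by rewrite -(comp1m u) -(comp1m v) -(bwd_fwd i) -!compA E.
Qed.

Lemma iso_epic (A B X : C) (i : Iso A B) (u v : Hom B X) :
  u ∘ i = v ∘ i -> u = v.
Proof.
move=> E.
by rewrite -(compm1 u) -(compm1 v) -(fwd_bwd i) !compA E.
Qed.

Lemma monic_comp (A B D : C) (g : Hom B D) (f : Hom A B) :
  monic g -> monic f -> monic (g ∘ f).
Proof. by move=> mg mf X u v; rewrite -!compA => /mg /mf. Qed.

Lemma monic_cancel (A B D : C) (g : Hom B D) (f : Hom A B) :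
  monic (g ∘ f) -> monic f.
Proof. by move=> m X u v E; apply: m; rewrite -!compA E. Qed.

Lemma tensmE (A A' B B' : C) (f : Hom A A') (g : Hom B B') :
  f ⊗ₘ g = (f ⊗ₘ idm B') ∘ (idm A ⊗ₘ g).
Proof. by rewrite -tensm_comp compm1 comp1m. Qed.

Lemma tensmE' (A A' B B' : C) (f : Hom A A') (g : Hom B B') :
  f ⊗ₘ g = (idm A' ⊗ₘ g) ∘ (f ⊗ₘ idm B).
Proof. by rewrite -tensm_comp compm1 comp1m. Qed.

Lemma tens1_inj (A B : C) (f g : Hom A B) :
  idm I ⊗ₘ f = idm I ⊗ₘ g -> f = g.
Proof. by move=> E; apply: (@iso_epic _ _ _ (lam A)); rewrite -!lam_nat E. Qed.

Lemma tensm1_inj (A B : C) (f g : Hom A B) :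
  f ⊗ₘ idm I = g ⊗ₘ idm I -> f = g.
Proof. by move=> E; apply: (@iso_epic _ _ _ (rho A)); rewrite -!rho_nat E. Qed.

Definition id_iso (A : C) : Iso A A.
Proof. by exists (idm A) (idm A); rewrite comp1m. Defined.

Definition inv_iso (A B : C) (i : Iso A B) : Iso B A.
Proof. by exists (bwd i) (fwd i); [exact: fwd_bwd | exact: bwd_fwd]. Defined.

Definition comp_iso (A B D : C) (j : Iso B D) (i : Iso A B) : Iso A D.
Proof.
exists (j ∘ i) (bwd i ∘ bwd j).
  by rewrite compA -(compA (bwd i)) bwd_fwd compm1 bwd_fwd.
by rewrite compA -(compA (fwd j)) fwd_bwd compm1 fwd_bwd.
Defined.

Definition tens_iso (A A' B B' : C) (i : Iso A A') (j : Iso B B') :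
  Iso (A ⊗ B) (A' ⊗ B').
Proof.
exists (fwd i ⊗ₘ fwd j) (bwd i ⊗ₘ bwd j).
  by rewrite -tensm_comp !bwd_fwd tensm_id.
by rewrite -tensm_comp !fwd_bwd tensm_id.
Defined.

Lemma lam_tens (A B : C) : (lam A ⊗ₘ idm B) ∘ alpha I A B = lam (A ⊗ B).
Proof.
apply: tens1_inj.
apply: (@iso_monic _ _ (alpha I A B)).
have E (X Y Z : C) (g : Hom Y Z) (f : Hom X Y) :
    idm I ⊗ₘ (g ∘ f) = (idm I ⊗ₘ g) ∘ (idm I ⊗ₘ f).
  by rewrite -tensm_comp comp1m.
have E' (X Y Z : C) (g : Hom Y Z) (f : Hom X Y) :
    (g ∘ f) ⊗ₘ idm B = (g ⊗ₘ idm B) ∘ (f ⊗ₘ idm B).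
  by rewrite -tensm_comp comp1m.
rewrite E compA alpha_nat -triangle E' -!compA !(compA (alpha I I A ⊗ₘ _)).
by rewrite -pentagon -triangle -tensm_id !compA alpha_nat.
Qed.

Lemma rho_tens (A B : C) : rho (A ⊗ B) ∘ alpha A B I = idm A ⊗ₘ rho B.
Proof.
apply: tensm1_inj.
apply: (@iso_epic _ _ _ (alpha A (B ⊗ I) I)).
apply: (@iso_epic _ _ _ (tens_iso (id_iso A) (alpha B I I))).
have E (X Y Z : C) (g : Hom Y Z) (f : Hom X Y) :
    (g ∘ f) ⊗ₘ idm I = (g ⊗ₘ idm I) ∘ (f ⊗ₘ idm I).
  by rewrite -tensm_comp comp1m.
rewrite /= E -!compA (compA (alpha A B I ⊗ₘ _)) -pentagon compA triangle.
rewrite -tensm_id -alpha_nat.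
rewrite (compA _ (alpha A (B ⊗ I) I)) -[in RHS]alpha_nat.
by rewrite -!compA -tensm_comp triangle comp1m.
Qed.

Lemma lam_rho_unit : fwd (lam I) = fwd (rho I).
Proof.
have lamI : idm I ⊗ₘ lam I = lam (I ⊗ I).
  by apply: (@iso_monic _ _ (lam I)); rewrite lam_nat.
apply: tensm1_inj.
apply: (@iso_epic _ _ _ (alpha I I I)).
by rewrite lam_tens triangle lamI.
Qed.

End Coherence.

Section Subunits.
Variable C : FirmCategory.
Notation I := (@unit_ob C).

Definition su_top : Subunit C.
Proof.
exists I (idm I); first by move=> X u v; rewrite !comp1m.
by exists (id_iso (I ⊗ I)); rewrite /= tensm_id.
Defined.

Definition meet_mor (s t : Subunit C) : Hom (su_dom s ⊗ su_dom t) I :=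
  lam I ∘ (su_mor s ⊗ₘ su_mor t).

Lemma meet_monic (s t : Subunit C) : monic (meet_mor s t).
Proof.
apply: monic_comp; first exact: iso_monic.
rewrite tensmE'; apply: monic_comp; last exact: firmP.
apply: (@monic_cancel _ _ _ _ (lam I)); rewrite lam_nat.
by apply: monic_comp; [exact: su_monic | exact: iso_monic].
Qed.

Definition swap_mid (A B D E : C) : Iso ((A ⊗ B) ⊗ (D ⊗ E)) ((A ⊗ D) ⊗ (B ⊗ E)) :=
  comp_iso (alpha A D (B ⊗ E))
   (comp_iso (tens_iso (id_iso A) (inv_iso (alpha D B E)))
    (comp_iso (tens_iso (id_iso A) (tens_iso (braid B D) (id_iso E)))
     (comp_iso (tens_iso (id_iso A) (alpha B D E))
       (inv_iso (alpha A B (D ⊗ E)))))).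

Lemma alphaV_nat (A A' B B' D D' : C)
    (f : Hom A A') (g : Hom B B') (h : Hom D D') :
  bwd (alpha A' B' D') ∘ ((f ⊗ₘ g) ⊗ₘ h) = (f ⊗ₘ (g ⊗ₘ h)) ∘ bwd (alpha A B D).
Proof.
apply: (@iso_monic _ _ _ (alpha A' B' D')).
rewrite !compA fwd_bwd comp1m alpha_nat -compA fwd_bwd compm1; done.
Qed.

Lemma swap_mid_nat (A B D E A' B' D' E' : C) (f : Hom A A') (g : Hom B B')
    (h : Hom D D') (k : Hom E E') :
  swap_mid A' B' D' E' ∘ ((f ⊗ₘ g) ⊗ₘ (h ⊗ₘ k)) =
  ((f ⊗ₘ h) ⊗ₘ (g ⊗ₘ k)) ∘ swap_mid A B D E.
Proof.
rewrite /= -!compA alphaV_nat.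
rewrite (compA (idm A' ⊗ₘ alpha _ _ _)) -tensm_comp comp1m alpha_nat.
rewrite -(compm1 f) tensm_comp -!compA (compA (idm A' ⊗ₘ (_ ⊗ₘ _))) -tensm_comp.
rewrite -tensm_comp braid_nat !comp1m -[k in LHS](compm1 k) tensm_comp.
rewrite -{1}(compm1 f) tensm_comp -!compA (compA (idm A' ⊗ₘ bwd _)) -tensm_comp.
rewrite alphaV_nat comp1m -{1}(compm1 f) tensm_comp.
by rewrite compm1 -!compA !(compA (alpha _ _ _)) alpha_nat -!compA.
Qed.

Lemma meet_idem (s t : Subunit C) :
  invertible (meet_mor s t ⊗ₘ idm (su_dom s ⊗ su_dom t)).
Proof.
have [i Ei] := su_idem s; have [j Ej] := su_idem t.
pose S := su_dom s; pose T := su_dom t.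
exists (comp_iso (tens_iso (lam I) (id_iso (S ⊗ T)))
        (comp_iso (inv_iso (swap_mid I I S T))
         (comp_iso (tens_iso i j) (swap_mid S T S T)))).
rewrite [LHS]/= Ei Ej.
have /= <- := swap_mid_nat (su_mor s) (su_mor t) (idm S) (idm T).
have /= E := bwd_fwd (swap_mid I I S T).
rewrite (compA (_ ∘ bwd _)) E comp1m -tensm_comp /meet_mor.
by rewrite tensm_id comp1m.
Qed.

Definition su_meet (s t : Subunit C) : Subunit C :=
  {| su_monic := @meet_monic s t; su_idem := meet_idem s t |}.

End Subunits.

Section SCat.
Variable C : FirmCategory.

Record SPair (A B : C) := {
  sp_sub : Subunit C;
  sp_mor : Hom (A ⊗ su_dom sp_sub) B
}.

Definition sequiv (A B : C) (p p' : SPair A B) : Prop :=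
  exists m : Iso (su_dom (sp_sub p')) (su_dom (sp_sub p)),
    su_mor (sp_sub p') = su_mor (sp_sub p) ∘ m /\
    sp_mor p' = sp_mor p ∘ (idm A ⊗ₘ m).

Lemma sequiv_refl (A B : C) (p : SPair A B) : sequiv p p.
Proof. by exists (id_iso _); rewrite /= tensm_id !compm1. Qed.

Lemma sequiv_sym (A B : C) (p q : SPair A B) : sequiv p q -> sequiv q p.
Proof.
move=> [m [Es Ef]]; exists (inv_iso m); rewrite /= Es Ef -!compA.
by rewrite -tensm_comp fwd_bwd comp1m tensm_id !compm1.
Qed.

Lemma sequiv_trans (A B : C) (p q r : SPair A B) :
  sequiv p q -> sequiv q r -> sequiv p r.
Proof.
move=> [m [Es Ef]] [n [Es' Ef']]; exists (comp_iso m n).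
by rewrite /= Es' Es Ef' Ef -!compA -tensm_comp comp1m.
Qed.

(** An equivalence class of [sequiv], as a predicate on representatives;
    [SHom_ext] makes equality of morphisms equality of classes. *)
Record SHom (A B : C) := {
  sclass : SPair A B -> Prop;
  sclassP : exists p, sclass = sequiv p
}.

Definition sclass_of (A B : C) (p : SPair A B) : SHom A B :=
  {| sclass := sequiv p; sclassP := ex_intro _ p eq_refl |}.

Definition smk (A B : C) (s : Subunit C) (f : Hom (A ⊗ su_dom s) B) : SHom A B :=
  sclass_of {| sp_mor := f |}.
Arguments smk [A B] s f.

Lemma SHom_ext (A B : C) (x y : SHom A B) :
  (forall p, sclass x p <-> sclass y p) -> x = y.
Proof.
case: x => P hP; case: y => Q hQ /= E.
have EPQ : P = Q.
  by apply: functional_extensionality => p; apply: propositional_extensionality.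
by case: Q / EPQ hQ {E} => hQ; rewrite (proof_irrelevance _ hP hQ).
Qed.

Lemma SHom_ind (A B : C) (x : SHom A B) : exists p, x = sclass_of p.
Proof. by case: (sclassP x) => p E; exists p; apply: SHom_ext; rewrite E. Qed.

Lemma sclass_of_eq (A B : C) (p q : SPair A B) :
  sclass_of p = sclass_of q <-> sequiv p q.
Proof.
split=> [E | E].
  by have : sclass (sclass_of p) q by rewrite E; exact: sequiv_refl.
apply: SHom_ext => r /=; split; apply: sequiv_trans => //.
exact: sequiv_sym.
Qed.

Definition spair_comp (A B D : C) (q : SPair B D) (p : SPair A B) : SPair A D :=
  {| sp_sub := su_meet (sp_sub p) (sp_sub q);
     sp_mor := sp_mor q ∘ (sp_mor p ⊗ₘ idm (su_dom (sp_sub q)))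
                 ∘ alpha A (su_dom (sp_sub p)) (su_dom (sp_sub q)) |}.

Lemma spair_comp_equiv (A B D : C) (q q' : SPair B D) (p p' : SPair A B) :
  sequiv p p' -> sequiv q q' -> sequiv (spair_comp q p) (spair_comp q' p').
Proof.
move=> [m [Es Ef]] [n [Et Eg]]; exists (tens_iso m n) => /=; split.
  by rewrite /meet_mor Es Et tensm_comp compA.
rewrite -[in RHS]compA alpha_nat !compA; congr (_ ∘ _).
rewrite Eg Ef -!compA -!tensm_comp comp1m.
by rewrite compm1 comp1m.
Qed.

(** The class of [spair_comp q p] for arbitrary representatives [q] of [y] and
    [p] of [x]; see [scomp_smk]. *)
Definition scomp_class (A B D : C) (y : SHom B D) (x : SHom A B) (r : SPair A D) : Prop :=
  exists q p, [/\ sclass y q, sclass x p & sequiv (spair_comp q p) r].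

Lemma scomp_classE (A B D : C) (q : SPair B D) (p : SPair A B) :
  scomp_class (sclass_of q) (sclass_of p) = sequiv (spair_comp q p).
Proof.
apply: functional_extensionality => r; apply: propositional_extensionality.
split=> [[q' [p' [/= Eq Ep E]]] | E].
  exact: (sequiv_trans (spair_comp_equiv Ep Eq) E).
by exists q, p; split=> //; exact: sequiv_refl.
Qed.

Lemma scomp_classP (A B D : C) (y : SHom B D) (x : SHom A B) :
  exists r, scomp_class y x = sequiv r.
Proof.
have [q ->] := SHom_ind y; have [p ->] := SHom_ind x.
by exists (spair_comp q p); exact: scomp_classE.
Qed.

Definition scomp (A B D : C) (y : SHom B D) (x : SHom A B) : SHom A D :=
  {| sclass := scomp_class y x; sclassP := scomp_classP y x |}.

Definition sid (A : C) : SHom A A := smk (su_top C) (rho A).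

Lemma scompE (A B D : C) (q : SPair B D) (p : SPair A B) :
  scomp (sclass_of q) (sclass_of p) = sclass_of (spair_comp q p).
Proof. by apply: SHom_ext => r /=; rewrite scomp_classE. Qed.

Lemma scomp_smk (A B D : C) (s t : Subunit C)
    (f : Hom (A ⊗ su_dom s) B) (g : Hom (B ⊗ su_dom t) D) :
  scomp (smk t g) (smk s f) =
  smk (su_meet s t)
    (g ∘ (f ⊗ₘ idm (su_dom t)) ∘ alpha A (su_dom s) (su_dom t)).
Proof. exact: scompE. Qed.

Lemma scompA (A B D E : C) (z : SHom D E) (y : SHom B D) (x : SHom A B) :
  scomp z (scomp y x) = scomp (scomp z y) x.
Proof.
have [r ->] := SHom_ind z; have [q ->] := SHom_ind y; have [p ->] := SHom_ind x.
rewrite !scompE; apply/sclass_of_eq/sequiv_sym.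
case: p q r => [s f] [t g] [u h].
pose S := su_dom s; pose T := su_dom t; pose U := su_dom u.
exists (inv_iso (alpha S T U)); split.
  apply: (@iso_epic _ _ _ _ (alpha S T U)); rewrite -[RHS]compA /= bwd_fwd compm1.
  rewrite /meet_mor -[su_mor u in LHS]comp1m tensm_comp -[su_mor s in RHS]comp1m.
  rewrite tensm_comp -!compA -alpha_nat !compA; congr (_ ∘ _).
  by rewrite -compA lam_tens lam_nat.
apply: (@iso_epic _ _ _ _ (tens_iso (id_iso A) (alpha S T U))).
rewrite -[RHS]compA /= -tensm_comp bwd_fwd comp1m tensm_id compm1.
have -> : ((g ∘ (f ⊗ₘ idm T) ∘ alpha A S T) ⊗ₘ idm U) =
          (g ⊗ₘ idm U) ∘ ((f ⊗ₘ idm T) ⊗ₘ idm U) ∘ (alpha A S T ⊗ₘ idm U).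
  by rewrite -!tensm_comp !comp1m.
rewrite -!compA; congr (_ ∘ (_ ∘ _)).
rewrite (compA (alpha A S T ⊗ₘ _)) -pentagon !compA; congr (_ ∘ _).
by rewrite -alpha_nat tensm_id.
Qed.

Lemma scomp1m (A B : C) (x : SHom A B) : scomp (sid B) x = x.
Proof.
have [[s f] ->] := SHom_ind x; rewrite scompE; apply/sclass_of_eq/sequiv_sym.
exists (rho (su_dom s)) => /=; split.
  by rewrite /meet_mor lam_rho_unit rho_nat.
by rewrite rho_nat -compA rho_tens.
Qed.

Lemma scompm1 (A B : C) (x : SHom A B) : scomp x (sid A) = x.
Proof.
have [[s f] ->] := SHom_ind x; rewrite scompE; apply/sclass_of_eq/sequiv_sym.
exists (lam (su_dom s)) => /=; split; first by rewrite /meet_mor lam_nat.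
by rewrite -compA triangle.
Qed.

Definition SCat : Category :=
  {| Ob := C; Hom := SHom; idm := sid; comp := scomp;
     compA := scompA; comp1m := scomp1m; compm1 := scompm1 |}.

End SCat.
Arguments smk {C} [A B] s f.

(* Main.v *)
(** Write [e_s = ρ ∘ (A ⊗ s)], so that the restriction of [[s,f]] is [[s,e_s]].
    The triangle axiom gives [g ∘ (e_s ⊗ T) ∘ α = g ∘ (A ⊗ λ(s ⊗ T))], hence
    [[t,e_t] ∘ [s,e_s] = [s ∧ t, e_(s ∧ t)]].  The axioms R1, R2 and R4 then
    come from [s ∧ s = s], [s ∧ t = t ∧ s] and [(s ∧ t) ∧ s = s ∧ t] as
    subobjects, while R3 holds on representatives.  In R4 the morphism
    components agree because they agree after composing with the monic [s]. *)

From Corelib Require Import ssreflect ssrfun ssrbool.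
From Stdlib Require Import FunctionalExtensionality PropExtensionality.
Require Import Defs.

Set Implicit Arguments.
Unset Strict Implicit.
Unset Printing Implicit Defensive.

(** Hexagon at [I, I, I]: after composing with [ρ ∘ (λ ⊗ I)], both sides begin
    with the isomorphism [λ ∘ β], which is cancelled. *)
Lemma rho_braid_unit (C : BraidedCategory) :
  rho unit_ob ∘ braid (unit_ob : C) unit_ob = lam (unit_ob : C).
Proof.
set I := (unit_ob : C).
apply: tens1_inj.
apply: (@iso_monic _ _ _ (comp_iso (lam I) (braid I I))) => /=.
have H := hexagon_l I I I.
have {H} : rho I ∘ ((lam I ⊗ₘ idm I) ∘ (alpha I I I ∘ braid (I ⊗ I) I ∘ alpha I I I))
   = rho I ∘ ((lam I ⊗ₘ idm I) ∘
      ((braid I I ⊗ₘ idm I) ∘ alpha I I I ∘ (idm I ⊗ₘ braid I I))).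
  by rewrite H.
rewrite !compA -(compA (rho I) (_ ⊗ₘ _) (alpha I I I)) lam_tens -lam_nat.
rewrite -(compA _ (idm I ⊗ₘ _)) -braid_nat -!compA triangle.
rewrite !compA rho_nat -(compA _ (rho (I ⊗ I))) rho_nat.
rewrite -!compA (compA (rho (I ⊗ I))) rho_tens -tensm_comp comp1m.
by move=> ->.
Qed.

Section SubunitEquivalence.
Variable C : FirmCategory.

(** Equality as subobjects of [unit_ob]; the isomorphism points backwards, from [t] to [s] in
    [su_equiv s t], to match [sequiv]. *)
Definition su_equiv (s s' : Subunit C) : Prop :=
  exists m : Iso (su_dom s') (su_dom s), su_mor s' = su_mor s ∘ m.

Lemma su_equiv_trans s t u : su_equiv s t -> su_equiv t u -> su_equiv s u.
Proof. by move=> [m E] [n F]; exists (comp_iso m n); rewrite F E compA. Qed.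

(** Exhibits an explicit factor through [s]; for [f := su_mor s] it is the comparison between
    [s ∧ s] and [s]. *)
Lemma su_mor_lam (s : Subunit C) (X : C) (f : Hom X unit_ob) :
  su_mor s ∘ (lam (su_dom s) ∘ (f ⊗ₘ idm (su_dom s))) =
  lam unit_ob ∘ (f ⊗ₘ su_mor s).
Proof. by rewrite compA -lam_nat -compA -tensm_comp comp1m compm1. Qed.

Lemma su_mor_rho (s : Subunit C) (X : C) (f : Hom X unit_ob) :
  su_mor s ∘ (rho (su_dom s) ∘ (idm (su_dom s) ⊗ₘ f)) =
  lam unit_ob ∘ (su_mor s ⊗ₘ f).
Proof. by rewrite compA -rho_nat -lam_rho_unit -compA -tensm_comp comp1m compm1. Qed.

(** Naturality carries the braiding to [I ⊗ I], where [rho_braid_unit] absorbs it. *)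
Lemma su_meetC s t : su_equiv (su_meet s t) (su_meet t s).
Proof.
exists (braid (su_dom t) (su_dom s)) => /=.
by rewrite /meet_mor -compA -braid_nat lam_rho_unit compA rho_braid_unit lam_rho_unit.
Qed.

(** The factor [λ ∘ (s ⊗ S)] is invertible precisely because [s ⊗ S] is. *)
Lemma su_meetss s : su_equiv s (su_meet s s).
Proof.
have [i Ei] := su_idem s.
by exists (comp_iso (lam (su_dom s)) i); rewrite /= Ei su_mor_lam.
Qed.

Lemma su_meetA s t u :
  su_equiv (su_meet (su_meet s t) u) (su_meet s (su_meet t u)).
Proof.
exists (alpha (su_dom s) (su_dom t) (su_dom u)) => /=; rewrite /meet_mor.
rewrite -[su_mor s in LHS]comp1m tensm_comp.
rewrite -[su_mor u in RHS]comp1m tensm_comp -!compA -alpha_nat !compA.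
by congr (_ ∘ _); rewrite -(compA _ _ (alpha _ _ _)) lam_tens lam_nat.
Qed.

Lemma su_meet_congl s s' t :
  su_equiv s s' -> su_equiv (su_meet s t) (su_meet s' t).
Proof.
move=> [m E]; exists (tens_iso m (id_iso (su_dom t))) => /=.
by rewrite /meet_mor E -compA -tensm_comp compm1.
Qed.

(** Chain: [s ∧ t = (s ∧ s) ∧ t = s ∧ (s ∧ t) = (s ∧ t) ∧ s]. *)
Lemma su_meet_absorb s t : su_equiv (su_meet s t) (su_meet (su_meet s t) s).
Proof.
apply: su_equiv_trans (su_meetC _ _).
apply: su_equiv_trans (su_meetA _ _ _).
exact/su_meet_congl/su_meetss.
Qed.

End SubunitEquivalence.

Section Restriction.
Variable C : FirmCategory.

Definition restr_pair (A : C) (s : Subunit C) : SPair A A :=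
  {| sp_sub := s; sp_mor := rho A ∘ (idm A ⊗ₘ su_mor s) |}.

Lemma restr_pair_equiv A s t :
  su_equiv s t -> sequiv (restr_pair A s) (restr_pair A t).
Proof. by move=> [m E]; exists m; rewrite /= E -compA -tensm_comp comp1m. Qed.

Lemma sequiv_su (A B : C) (p q : SPair A B) :
  sequiv p q -> su_equiv (sp_sub p) (sp_sub q).
Proof. by move=> [m [E _]]; exists m. Qed.

(** Ranges over all representatives, like [scomp_class]; they yield one class since [restr_pair]
    depends only on the subunit. *)
Definition srestr_class (A B : C) (x : SHom A B) (r : SPair A A) : Prop :=
  exists p, sclass x p /\ sequiv (restr_pair A (sp_sub p)) r.

Lemma srestr_classE (A B : C) (p : SPair A B) :
  srestr_class (sclass_of p) = sequiv (restr_pair A (sp_sub p)).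
Proof.
apply: functional_extensionality => r; apply: propositional_extensionality.
split=> [[q [/sequiv_su /(restr_pair_equiv A) E]] | E].
  exact: sequiv_trans.
by exists p; split=> //; exact: sequiv_refl.
Qed.

Lemma srestr_classP (A B : C) (x : SHom A B) :
  exists r, srestr_class x = sequiv r.
Proof.
have [p ->] := SHom_ind x.
by exists (restr_pair A (sp_sub p)); exact: srestr_classE.
Qed.

Definition srestr (A B : C) (x : SHom A B) : SHom A A :=
  {| sclass := srestr_class x; sclassP := srestr_classP x |}.

Lemma srestrE (A B : C) (p : SPair A B) :
  srestr (sclass_of p) = sclass_of (restr_pair A (sp_sub p)).
Proof. by apply: SHom_ext => r /=; rewrite srestr_classE. Qed.

(** Naturality of [alpha] moves [s] to the middle factor, where the triangle replaces [ρ ⊗ T] by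
    [A ⊗ λ]. *)
Lemma spair_comp_restr_mor (A B : C) (s : Subunit C) (q : SPair A B) :
  sp_mor (spair_comp q (restr_pair A s)) =
  sp_mor q ∘ (idm A ⊗ₘ (lam _ ∘ (su_mor s ⊗ₘ idm (su_dom (sp_sub q))))).
Proof.
rewrite /= -compA; congr (_ ∘ _).
rewrite -[idm (su_dom _) in LHS](comp1m (idm _)) tensm_comp -compA -alpha_nat.
by rewrite compA triangle -tensm_comp comp1m.
Qed.

Lemma spair_comp_restr (A : C) (s t : Subunit C) :
  sclass_of (spair_comp (restr_pair A t) (restr_pair A s)) =
  sclass_of (restr_pair A (su_meet s t)).
Proof.
apply/sclass_of_eq; exists (id_iso _); split; first by rewrite /= compm1.
rewrite spair_comp_restr_mor /= tensm_id compm1 -!compA -tensm_comp comp1m.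
by rewrite su_mor_lam.
Qed.

Lemma srestr_R1 (A B : C) (x : SHom A B) : scomp x (srestr x) = x.
Proof.
have [p ->] := SHom_ind x; rewrite srestrE scompE; apply/sclass_of_eq/sequiv_sym.
have [i Ei] := su_idem (sp_sub p).
(* The isomorphism of [su_meetss] is given explicitly, as it must also match the morphism
   components. *)
exists (comp_iso (lam _) i); split; first by rewrite /= Ei su_mor_lam.
by rewrite spair_comp_restr_mor /= Ei.
Qed.

Lemma srestr_R2 (A B B' : C) (x : SHom A B) (y : SHom A B') :
  scomp (srestr x) (srestr y) = scomp (srestr y) (srestr x).
Proof.
have [p ->] := SHom_ind x; have [q ->] := SHom_ind y.
rewrite !srestrE !scompE !spair_comp_restr.
exact/sclass_of_eq/restr_pair_equiv/su_meetC.
Qed.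

Lemma srestr_R3 (A B B' : C) (x : SHom A B) (y : SHom A B') :
  srestr (scomp y (srestr x)) = scomp (srestr y) (srestr x).
Proof.
have [p ->] := SHom_ind x; have [q ->] := SHom_ind y.
by rewrite !srestrE !scompE srestrE spair_comp_restr.
Qed.

Lemma srestr_R4 (A B B' : C) (x : SHom A B) (y : SHom B B') :
  scomp (srestr y) x = scomp x (srestr (scomp y x)).
Proof.
have [[s f] ->] := SHom_ind x; have [[t g] ->] := SHom_ind y.
rewrite scompE !srestrE !scompE; apply/sclass_of_eq.
have [m Em] := su_meet_absorb s t; exists m; split=> //.
rewrite spair_comp_restr_mor /=.
(* Interchanging [f] with [t] and sliding [ρ] past [f] turns the right side into
   [f ∘ (A ⊗ (ρ ∘ (S ⊗ t) ∘ m))]. *)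
rewrite -(compA (rho B)) -tensm_comp comp1m compm1 (tensmE f) !compA rho_nat.
rewrite -tensm_id -!compA (compA (_ ⊗ₘ su_mor t)) -alpha_nat !compA.
rewrite -(compA f (rho _)) rho_tens -!compA -!tensm_comp !comp1m.
(* All that is known of [m] is [Em], an equation of maps into [I]; composing with [s] brings both
   sides to that form. *)
congr (f ∘ (idm A ⊗ₘ _)); apply: (@su_monic _ s).
by rewrite su_mor_lam -[LHS]/(su_mor (su_meet (su_meet s t) s)) Em !compA
  -(compA (su_mor s)) su_mor_rho.
Qed.

End Restriction.

Theorem proposition3p4 (C : FirmCategory) :
  exists R : RestrictionStructure (SCat C),
    forall (A B : C) (s : Subunit C) (f : Hom (A ⊗ su_dom s) B),
      restr (C := SCat C) R (smk s f) =
      smk s (rho A ∘ (idm A ⊗ₘ su_mor s)).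
Proof.
exists (Build_RestrictionStructure (C := SCat C)
  (@srestr_R1 C) (@srestr_R2 C) (@srestr_R3 C) (@srestr_R4 C)).
by move=> A B s f; exact: srestrE.
Qed.
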